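(* Let $f=(f_1,\ldots,f_k)$ be an IFS of positive Lipschitz contractions on the unit interval, ordered so that $\max\{f_i(0),f_i(1)\}\le \max\{f_{i+1}(0),f_{i+1}(1)\}$ for $i=1,\dots,k-1$, such that $f_i(0,1)\cap f_j(0,1)=\emptyset$ for all $i,j=1,\ldots,k$ with $i\neq j$. Let $p=(p_1,\dots,p_k)$ and $q=(q_1,\dots,q_k)$ be probability vectors in $(0,1)^k$ such that, for $\mathcal{A}=\mathbb{R}^{\ge 0}$ or $\mathcal{A}=\mathbb{R}^{\le 0}$, $$\sum_{i=1}^m (p_i-q_i)\in\mathcal{A}\quad\text{for every } m=1,2,\ldots,k.$$ Then $$W_1\left(\mu^{(f,p)},\mu^{(f,q)}\right)=\left|\int x\, d\left(\mu^{(f,p)}-\mu^{(f,q)}\right)(x)\right|.$$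
   Context: A Lipschitz contraction is a map $h:\mathbb{R}\to\mathbb{R}$ with $\sup_{x\neq y}|h(x)-h(y)|/|x-y|<1$; it is positive if it is differentiable with derivative $>0$. An IFS of positive Lipschitz contractions on the unit interval is a finite tuple $f=(f_1,\dots,f_k)$ of positive Lipschitz contractions, each mapping $[0,1]$ into $[0,1]$. For a probability vector $p=(p_1,\dots,p_k)$, the stationary probability measure $\mu^{(f,p)}$ is the unique Borel probability measure $\mu$ on $[0,1]$ with $\mu(A)=\sum_{i=1}^k p_i\,\mu(f_i^{-1}(A))$ for all Borel sets $A$; equivalently $\int\phi\,d\mu=\sum_{i=1}^k p_i\int \phi\circ f_i\,d\mu$ for every continuous $\phi:[0,1]\to\mathbb{R}$. The first Wasserstein distance is $W_1(\mu,\nu)=\inf\{\mathbb{E}|X-Y|:\mathrm{law}(X)=\mu,\ \mathrm{law}(Y)=\nu\}$. *)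

(* Defs.v *)
From mathcomp Require Import all_boot all_order all_algebra.
From mathcomp Require Import all_classical all_reals all_analysis.

Set Implicit Arguments.
Unset Strict Implicit.
Unset Printing Implicit Defensive.

Import Order.TTheory GRing.Theory Num.Theory.
Import numFieldNormedType.Exports.

Local Open Scope classical_set_scope.
Local Open Scope ring_scope.

(* The supremum is taken in \bar R, so an unbounded set of difference quotients
   gives +oo and is excluded (a real-valued sup would default to 0). *)
Definition lipschitz_contraction (R : realType) (h : R -> R) : Prop :=
  (ereal_sup [set e : \bar R |
     exists x y : R, x != y /\ e = (`|h x - h y| / `|x - y|)%:E] < 1)%E.

Definition positive_lipschitz_contraction (R : realType) (h : R -> R) : Prop :=
  lipschitz_contraction h /\ forall x : R, derivable h x 1 /\ 0 < derive1 h x.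

Definition positive_IFS (R : realType) (k : nat) (f : 'I_k -> R -> R) : Prop :=
  forall i : 'I_k, positive_lipschitz_contraction (f i) /\
    f i @` `[0, 1] `<=` `[0, 1].

Definition probability_vector (R : realType) (k : nat) (p : 'I_k -> R) : Prop :=
  (forall i : 'I_k, 0 <= p i) /\ \sum_(i < k) p i = 1.

(* A Borel probability measure on [0, 1] is encoded as a Borel probability
   measure on R giving full mass to [0, 1]. *)
Definition stationary_measure (R : realType) (k : nat)
    (f : 'I_k -> R -> R) (p : 'I_k -> R)
    (mu : probability (measurableTypeR R) R) : Prop :=
  mu `[0, 1]%classic = 1%E /\
  forall A : set R, measurable A ->
    mu A = (\sum_(i < k) (p i)%:E * mu (f i @^-1` A))%E.

(* Equality only on Borel sets: a library measure also takes (meaningless)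
   values on non-measurable sets. *)
Definition has_law (R : realType) (d : measure_display) (T : measurableType d)
    (P : probability T R) (X : {RV P >-> R})
    (mu : probability (measurableTypeR R) R) : Prop :=
  forall A : set R, measurable A -> distribution P X A = mu A.

Definition W1 (R : realType) (mu nu : probability (measurableTypeR R) R) :
    \bar R :=
  ereal_inf [set e : \bar R |
    exists (d : measure_display) (T : measurableType d) (P : probability T R)
      (X Y : {RV P >-> R}),
      [/\ has_law X mu, has_law Y nu &
          e = ('E_P[fun w => (`|X w - Y w|)%R])%E]].

(* Main.v *)
From HB Require Import structures.
Require Import Defs.
From mathcomp Require Import all_boot all_order all_algebra.
From mathcomp Require Import all_classical all_reals all_analysis.
From mathcomp Require Import measurable_realfun ring.

(** Both sides compare [mu] and [nu] through their cumulative distribution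
functions [F] and [G]. The inequality [|E X - E Y| <= E |X - Y|] shows that
[W1 mu nu] is always at least the distance between the means ([W1_ge]). It is
an equality as soon as some coupling satisfies [X <= Y] everywhere, for then
[E |X - Y| = E Y - E X]. If [G <= F] pointwise, such a coupling exists: apply
the two quantile functions to one uniform variable on [0, 1]
([W1_of_cdf_le]).

So everything rests on the stochastic dominance [G <= F], under the assumption
that the partial sums of [p - q] are nonnegative ([stationary_cdf_le]); the
other case follows by exchanging the roles of the measures. The branches are
increasing and the images of the open interval are disjoint, so they are
stacked from left to right: [f i 1 <= f j 0] for [i < j]
([IFS_branches_ordered]). Stationarity reads
[F x = \sum_i p i * a i] and [G x = \sum_i q i * b i], with [a i] and [b i] the
masses of [f i @^-1` ]-oo, x]] under [mu] and [nu]. Hence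
[G x - F x = \sum_i p i * (b i - a i) - \sum_i (p i - q i) * b i].
The sequence [b] is nonnegative and nonincreasing, so the second sum is
nonnegative by Abel summation ([sum_ord_partial_sums_ge0]). In the first sum
[a i = b i], with value 0 or 1, except for at most one index [i], for which
[x = f i y] for some [y], so that [b i - a i = G y - F y]. With
[D = sup (G - F)] and [c < 1] a bound of the [p i], this gives [D <= c * D],
hence [D <= 0]. *)

Import Order.TTheory GRing.Theory Num.Theory.
Import numFieldNormedType.Exports.

Local Open Scope classical_set_scope.
Local Open Scope ring_scope.

(** * Random variables with a given law carried by the unit interval *)

Lemma probability_setI_full d (T : measurableType d) (R : realType)
    (P : probability T R) (A D : set T) :
  measurable A -> measurable D -> P D = 1%E -> P (A `&` D) = P A.
Proof.
move=> mA mD PD1.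
have PDC : P (~` D) = 0%E by rewrite probability_setC// PD1 subee.
have AD0 : P (A `\` D) = 0%E.
  apply: (@subset_measure0 _ _ _ P _ (~` D)) => //.
    exact: measurableD.
  exact: measurableC.
have -> : P A = (P (A `\` D) + P (A `&` D))%E by exact: measureDI.
by rewrite AD0 add0e.
Qed.

Lemma le_probability_full d (T : measurableType d) (R : realType)
    (P : probability T R) (A B D : set T) :
  measurable A -> measurable B -> measurable D -> P D = 1%E ->
  A `&` D `<=` B -> (P A <= P B)%E.
Proof.
move=> mA mB mD PD1 ADB; rewrite -(probability_setI_full _ _ _ _ _ _ mA mD PD1).
by apply: le_measure => //; rewrite inE//; exact: measurableI.
Qed.

Section law.
Context {R : realType} {d : measure_display} {T : measurableType d}.
Context {P : probability T R} {X : {RV P >-> R}}.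
Context {mu : probability (measurableTypeR R) R}.
Hypothesis lawX : has_law X mu.
Hypothesis mu01 : mu `[0, 1]%classic = 1%E.

Let preimage01 : measurable (X @^-1` `[0, 1]).
Proof. exact: measurable_funPTI. Qed.

Let preimage01C0 : P (~` (X @^-1` `[0, 1])) = 0%E.
Proof.
rewrite probability_setC//.
have := lawX `[0, 1]%classic; rewrite mu01 => /(_ (measurable_itv _)).
by rewrite /distribution /pushforward => ->; rewrite subee.
Qed.

Let integrable01 : P.-integrable (X @^-1` `[0, 1]) (EFin \o X).
Proof.
apply: measurable_bounded_integrable => //.
- by rewrite (le_lt_trans (probability_le1 _ _))// ltry.
- exact: measurable_funTS.
- exists 1; split; first exact: num_real.
  move=> M M1 x /=; rewrite in_itv/= => /andP[x0 x1].
  by rewrite ger0_norm// (le_trans x1)// ltW.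
Qed.

Lemma has_law_integrable : P.-integrable setT (EFin \o X).
Proof.
apply/(negligible_integrable (measurableC preimage01)) => //.
  exact/measurable_EFinP.
by rewrite setTD setCK.
Qed.

(* [R] and [measurableTypeR R] carry the same sigma-algebra but distinct
   structures; [XR] is [X] with its law living on the latter, as [mu] does. *)
Let XR : T -> measurableTypeR R := X.

#[local] HB.instance Definition _ :=
  @isMeasurableFun.Build _ _ _ _ XR (measurable_funPT X).

Lemma has_law_integral :
  (\int[P]_w (X w)%:E = \int[mu]_(x in `[0%R, 1%R]) x%:E)%E.
Proof.
rewrite (negligible_integral (measurableC preimage01) measurableT
  has_law_integrable preimage01C0) setTD setCK.
transitivity (\int[distribution P XR]_(x in `[0%R, 1%R]) x%:E)%E.
  rewrite (@integral_pushforward _ _ _ _ _ XR (measurable_funPT X) P _ EFin)//.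
by apply: (@eq_measure_integral _ _ _ _ mu (distribution P XR)) => A mA _; exact: lawX.
Qed.

End law.

(** * The Wasserstein distance dominates the distance between the means *)

(** This is [|E X - E Y| <= E |X - Y|], applied to every coupling. *)
Lemma W1_ge (R : realType) (mu nu : probability (measurableTypeR R) R) :
  mu `[0, 1]%classic = 1%E -> nu `[0, 1]%classic = 1%E ->
  (`| \int[mu]_(x in `[0%R, 1%R]) x%:E - \int[nu]_(x in `[0%R, 1%R]) x%:E |
    <= W1 mu nu)%E.
Proof.
move=> mu01 nu01; apply: le_ereal_inf_tmp => _ [d [T [P [X [Y [lX lY ->]]]]]].
rewrite -(has_law_integral lX mu01) -(has_law_integral lY nu01).
rewrite -integralB_EFin//;
  [|exact: (has_law_integrable lX)|exact: (has_law_integrable lY)].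
rewrite unlock.
apply: le_trans (le_abse_integral _ _ _) _ => //.
by apply/measurable_EFinP; exact: measurable_funB.
Qed.

Lemma W1C (R : realType) (mu nu : probability (measurableTypeR R) R) :
  W1 mu nu = W1 nu mu.
Proof.
rewrite /W1; congr ereal_inf; apply/seteqP; split => e;
  move=> [d [T [P [X [Y [lX lY ->]]]]]]; exists d, T, P, Y, X; split => //;
  by congr expectation; apply/funext => w; rewrite distrC.
Qed.

(** * Distribution functions and quantiles *)

(** The half-lines form a pi-system generating the Borel sets. *)
Lemma probability_eq_cdf (R : realType) (mu nu : probability (measurableTypeR R) R) :
  (forall x : R, mu `]-oo, x]%classic = nu `]-oo, x]%classic) ->
  forall A, measurable A -> mu A = nu A.
Proof.
move=> munu A mA.
apply: (@measure_unique _ R (measurableTypeR R) [set `]-oo, x]%classic | x in [set: R]]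
  (fun n => `]-oo, n%:R]%classic)).
- rewrite RGenOInfty.measurableE; apply/seteqP; split.
    apply: smallest_sub; first exact: smallest_sigma_algebra.
    move=> _ [x ->]; rewrite -setCitvl.
    apply: (@measurableC _ (g_sigma_algebraType _)).
    by apply: sub_sigma_algebra; exists x.
  apply: smallest_sub; first exact: smallest_sigma_algebra.
  by move=> _ [x _ <-]; exact: RGenOInfty.measurable_itv_bounded.
- move=> _ _ [x _ <-] [y _ <-]; exists (Num.min x y) => //.
  by apply/seteqP; split => z /=; rewrite !in_itv/= le_min => /andP.
- by move=> n; exists n%:R.
- rewrite -subTset => x _; exists (Num.truncn x).+1 => //=.
  by rewrite in_itv/= ltW// truncnS_gt.
- by move=> _ [x _ <-]; exact: munu.
- by move=> n; rewrite (le_lt_trans (probability_le1 _ _))// ltry.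
- exact: mA.
Qed.

Section law_cdf.
Context {R : realType} {d : measure_display} {T : measurableType d}.
Context {P : probability T R} (X : {RV P >-> R}).
Context {mu : probability (measurableTypeR R) R}.

Let XR : T -> measurableTypeR R := X.

#[local] HB.instance Definition _ :=
  @isMeasurableFun.Build _ _ _ _ XR (measurable_funPT X).

(** To have law [mu] it suffices to have the distribution function of [mu]. *)
Lemma has_law_cdf :
  (forall x : R, P (X @^-1` `]-oo, x]) = mu `]-oo, x]%classic) -> has_law X mu.
Proof. exact: (@probability_eq_cdf _ (distribution P XR)). Qed.

End law_cdf.

Section cdfR.
Context {R : realType} (mu : probability (measurableTypeR R) R).

(** The real-valued cumulative distribution function of [mu]. *)
Definition cdfR (x : R) : R := fine (mu `]-oo, x]%classic).

(* The identity, as a random variable with law [mu]. *)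
Let idR : measurableTypeR R -> R := idfun.

#[local] HB.instance Definition _ :=
  @isMeasurableFun.Build _ _ _ _ idR (@measurable_id _ _ setT).

Lemma cdfRE x : mu `]-oo, x]%classic = (cdfR x)%:E.
Proof. by rewrite /cdfR fineK// fin_num_measure. Qed.

Lemma cdfR_nondecreasing : nondecreasing_fun cdfR.
Proof.
move=> x y xy; rewrite -lee_fin -!cdfRE.
exact: (cdf_nondecreasing (idR : {RV mu >-> R})).
Qed.

Lemma cdfR_right_continuous : right_continuous cdfR.
Proof.
move=> a; apply: fine_cvg; rewrite -/(cdfR a) -cdfRE.
exact: (@cdf_right_continuous _ _ _ _ (idR : {RV mu >-> R}) a).
Qed.

Lemma cdfR_ge0 x : 0 <= cdfR x.
Proof. exact: fine_ge0. Qed.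

Lemma cdfR_le1 x : cdfR x <= 1.
Proof. by rewrite -lee_fin -cdfRE probability_le1. Qed.

Hypothesis mu01 : mu `[0, 1]%classic = 1%E.

Lemma cdfR_eq0 x : x < 0 -> cdfR x = 0.
Proof.
move=> x0; apply/eqP; rewrite eq_le cdfR_ge0 andbT -lee_fin -cdfRE.
rewrite -[leRHS](measure0 mu).
apply: (@le_probability_full _ (measurableTypeR R) _ mu _ _ `[0, 1]%classic) => //.
move=> y [] /=; rewrite !in_itv/= => yx /andP[y0 _].
by have := le_lt_trans (le_trans y0 yx) x0; rewrite ltxx.
Qed.

Lemma cdfR_eq1 x : 1 <= x -> cdfR x = 1.
Proof.
move=> x1; apply/eqP; rewrite eq_le cdfR_le1 -lee_fin -cdfRE /= -mu01.
apply: le_measure; rewrite ?inE//.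
by move=> y /=; rewrite !in_itv/= => /andP[_ /le_trans]; exact.
Qed.

End cdfR.

Section quantile.
Context {R : realType}.
Implicit Types (F G : R -> R) (u x : R).

(** The points of [0, 1] at which [F] reaches the level [u]. The point 1 is
always included, so that the set is never empty, even for [u > 1]. *)
Definition quantile01_set F u : set R :=
  [set x | 0 <= x <= 1 /\ (u <= F x \/ x = 1)].

(** The generalized inverse of [F], with values in [0, 1]. *)
Definition quantile01 F u : R := inf (quantile01_set F u).

Let has_inf_set F u : has_inf (quantile01_set F u).
Proof.
split; first by exists 1; split; [rewrite ler01 lexx|right].
by exists 0 => x [/andP[]].
Qed.

Lemma quantile01_ge0 F u : 0 <= quantile01 F u.
Proof.
apply: lb_le_inf; first by case: (has_inf_set F u).
by move=> x [/andP[]].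
Qed.

Lemma quantile01_le1 F u : quantile01 F u <= 1.
Proof.
apply: ge_inf; first by case: (has_inf_set F u).
by split; [rewrite ler01 lexx|right].
Qed.

Lemma quantile01_nondecreasing F : nondecreasing_fun (quantile01 F).
Proof.
move=> u v uv; apply: lb_le_inf; first by case: (has_inf_set F v).
move=> x [x01 vFx]; apply: ge_inf; first by case: (has_inf_set F u).
by split => //; case: vFx => [/(le_trans uv)|]; [left|right].
Qed.

Lemma le_quantile01 F G u : (forall x, F x <= G x) ->
  quantile01 G u <= quantile01 F u.
Proof.
move=> FG; apply: lb_le_inf; first by case: (has_inf_set F u).
move=> x [x01 uFx]; apply: ge_inf; first by case: (has_inf_set G u).
by split => //; case: uFx => [/le_trans/(_ (FG x))|]; [left|right].
Qed.

(** Right continuity makes the infimum attained; this gives the Galois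
connection between [F] and its generalized inverse. *)
Lemma quantile01_leE F u x : nondecreasing_fun F -> right_continuous F ->
  F 1 = 1 -> u <= 1 -> 0 <= x <= 1 -> (quantile01 F u <= x) = (u <= F x).
Proof.
move=> Fnd Frc F1 u1 x01; apply/idP/idP => [qx|uFx]; last first.
  by apply: ge_inf; [case: (has_inf_set F u)|split => //; left].
rewrite leNgt; apply/negP => Fxu.
have Fr : \forall y \near x^'+, F y < u by exact: (cvgr_lt _ (Frc x)).
have [y [xy Fyu]] : exists y, x < y /\ F y < u.
  apply: (@filter_ex _ x^'+); near=> y; split; near: y => //.
  exact: nbhs_right_gt.
have [s [s01 us] sy] := inf_lt (has_inf_set F u).1 (le_lt_trans qx xy).
have uFs : u <= F s by case: us => // ->; rewrite F1.
by have := le_lt_trans (le_trans uFs (Fnd _ _ (ltW sy))) Fyu; rewrite ltxx.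
Unshelve. all: by end_near. Qed.

End quantile.

Lemma uniform01E (R : realType) (A : set (measurableTypeR R)) :
  measurable A ->
  uniform_prob (@ltr01 R) A = lebesgue_measure (A `&` `[0, 1]).
Proof.
move=> mA; rewrite -{1}(setIT A) -integral_indic//.
rewrite (integral_uniform (@ltr01 R) (f := EFin \o \1_A)) //=.
- by rewrite subr0 invr1 mul1e integral_indic.
- exact/measurable_EFinP.
Qed.

Section quantile_law.
Context {R : realType} (mu : probability (measurableTypeR R) R).

(** The quantile function of [mu], as a random variable. *)
Definition quantile_rv : measurableTypeR R -> R := quantile01 (cdfR mu).

Let measurable_quantile_rv : measurable_fun setT quantile_rv.
Proof. exact: nondecreasing_measurable (quantile01_nondecreasing _). Qed.

HB.instance Definition _ :=
  @isMeasurableFun.Build _ _ _ _ quantile_rv measurable_quantile_rv.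

Hypothesis mu01 : mu `[0, 1]%classic = 1%E.

(** Inverse transform sampling. *)
Lemma has_law_quantile :
  has_law (quantile_rv : {RV (uniform_prob (@ltr01 R)) >-> R}) mu.
Proof.
apply: has_law_cdf => x; rewrite cdfRE.
have mq : measurable (quantile_rv @^-1` `]-oo, x]).
  by rewrite -[X in measurable X]setTI; exact: measurable_quantile_rv.
have [x0|x0] := ltP x 0.
  rewrite (cdfR_eq0 _ mu01)// (_ : _ @^-1` _ = set0) ?measure0//.
  apply/seteqP; split => // u /=; rewrite in_itv/= => qx.
  by have := le_lt_trans (le_trans (quantile01_ge0 _ u) qx) x0; rewrite ltxx.
have [x1|x1] := leP 1 x.
  rewrite (cdfR_eq1 _ mu01)// (_ : _ @^-1` _ = setT) ?probability_setT//.
  apply/seteqP; split => // u _ /=; rewrite in_itv/=.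
  exact: le_trans (quantile01_le1 _ _) x1.
etransitivity; first exact: (uniform01E R _ mq).
rewrite (_ : _ `&` _ = `[0, cdfR mu x]%classic).
  rewrite lebesgue_measure_itv/= lte_fin sube0.
  have := cdfR_ge0 mu x; rewrite le_eqVlt => /predU1P[<-|->//].
  by rewrite ltxx.
have qE (u : R) : u <= 1 -> (quantile_rv u <= x) = (u <= cdfR mu x).
  move=> u1; apply: quantile01_leE => //.
  - exact: cdfR_nondecreasing.
  - exact: cdfR_right_continuous.
  - exact: cdfR_eq1.
  - by rewrite x0 ltW.
apply/seteqP; split => u /=; rewrite !in_itv/=.
  by move=> [+ /andP[-> u1]]; rewrite qE.
move=> /andP[u0 uF]; have u1 : u <= 1 := le_trans uF (cdfR_le1 mu x).
by rewrite qE// u0 u1.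
Qed.

End quantile_law.

(** * Stochastic dominance determines the Wasserstein distance *)

Lemma mean01_fin_num (R : realType) (mu : probability (measurableTypeR R) R) :
  mu `[0, 1]%classic = 1%E ->
  (\int[mu]_(x in `[0%R, 1%R]) x%:E)%E \is a fin_num.
Proof.
move=> mu01; have lmu := has_law_quantile mu mu01.
rewrite -(has_law_integral lmu mu01); apply: integrable_fin_num => //.
exact: (has_law_integrable lmu).
Qed.

Lemma abse_subC (R : numDomainType) (x y : \bar R) :
  y \is a fin_num -> (`|x - y| = `|y - x|)%E.
Proof. by move=> yfin; rewrite -abseN fin_num_oppeB// addeC. Qed.

(** The quantile coupling of [mu] and [nu] is monotone, hence optimal. *)
Lemma W1_of_cdf_le (R : realType) (mu nu : probability (measurableTypeR R) R) :
  mu `[0, 1]%classic = 1%E -> nu `[0, 1]%classic = 1%E ->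
  (forall x, cdfR nu x <= cdfR mu x) ->
  W1 mu nu =
    (`| \int[mu]_(x in `[0%R, 1%R]) x%:E - \int[nu]_(x in `[0%R, 1%R]) x%:E |)%E.
Proof.
move=> mu01 nu01 numu; apply/eqP; rewrite eq_le W1_ge// andbT.
have lmu := has_law_quantile mu mu01; have lnu := has_law_quantile nu nu01.
apply: ge_ereal_inf.
exists ('E_(uniform_prob (@ltr01 R))
  [fun w => (`|quantile_rv mu w - quantile_rv nu w|)%R])%E.
  by exists _, _, (uniform_prob (@ltr01 R)), (quantile_rv mu), (quantile_rv nu).
(* The quantile of [mu] lies below that of [nu], so the coupling cost is the
   integral of their difference. *)
rewrite abse_subC ?mean01_fin_num//.
rewrite -(has_law_integral lmu mu01) -(has_law_integral lnu nu01).
rewrite -integralB_EFin//;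
  [|exact: (has_law_integrable lnu)|exact: (has_law_integrable lmu)].
rewrite unlock (_ : (fun x => `|_|%:E) =
  fun x => ((quantile_rv nu x)%:E - (quantile_rv mu x)%:E)%E).
  exact: lee_abs.
apply/funext => u; rewrite -EFinB distrC ger0_norm// subr_ge0.
exact: le_quantile01.
Qed.

(** * Abel summation and a bound for finitely many weights *)

(** Summation by parts writes the sum as a combination of the partial sums of
[c] with nonnegative coefficients. *)
Lemma sum_partial_sums_ge0 (R : realDomainType) (c b : nat -> R) (n : nat) :
  (forall i, (i < n)%N -> 0 <= b i) ->
  (forall i, (i.+1 < n)%N -> b i.+1 <= b i) ->
  (forall m, (1 <= m <= n)%N -> 0 <= \sum_(i < m) c i) ->
  0 <= \sum_(i < n) c i * b i.
Proof.
case: n => [|n] b0 bdec cs; first by rewrite big_ord0.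
(* Induction needs the sharper lower bound by [b m] times the partial sum. *)
suff H m : (m <= n)%N -> b m * \sum_(i < m.+1) c i <= \sum_(i < m.+1) c i * b i.
  by rewrite (le_trans _ (H n (leqnn _)))// mulr_ge0 ?b0 ?cs//= leqnn.
elim: m => [|m IH] mn; first by rewrite !big_ord_recr !big_ord0 /= !add0r mulrC.
rewrite big_ord_recr [leRHS]big_ord_recr/= mulrDr mulrC [X in _ + X]mulrC.
rewrite lerD2r (le_trans _ (IH (ltnW mn)))// mulrC ler_wpM2r//.
  by apply: cs; rewrite /= ltnW.
exact: bdec.
Qed.

Lemma sum_ord_partial_sums_ge0 (R : realDomainType) (k : nat) (c b : 'I_k -> R) :
  (forall i, 0 <= b i) ->
  (forall i j : 'I_k, (i < j)%N -> b j <= b i) ->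
  (forall m, (1 <= m <= k)%N -> 0 <= \sum_(i < k | (i < m)%N) c i) ->
  0 <= \sum_(i < k) c i * b i.
Proof.
case: k c b => [|k] c b b0 bdec cs; first by rewrite big_ord0.
have := @sum_partial_sums_ge0 R (c \o inord) (b \o inord) k.+1.
under eq_bigr do rewrite /= inord_val.
apply => [i _|i ik|m /andP[m1 mk]]; first exact: b0.
  by apply: bdec; rewrite !inordK// ltnW.
rewrite (big_ord_widen k.+1 (c \o inord))//.
by under eq_bigr do rewrite /= inord_val; rewrite cs// m1.
Qed.

Lemma exists_lt1_bound (R : realType) (k : nat) (p : 'I_k -> R) :
  (forall i, p i < 1) ->
  exists c, [/\ 0 <= c, c < 1 & forall i, p i <= c].
Proof.
move=> p1; exists (\big[Num.max/0]_i p i); split.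
- exact: bigmax_ge_id.
- by apply: bigmax_lt => //; rewrite ltr01.
- by move=> i; exact: le_bigmax.
Qed.

(** * One increasing branch *)

Section increasing_branch.
Context {R : realType} {h : R -> R}.
Hypothesis hh : positive_lipschitz_contraction h.

Lemma positive_contraction_continuous (A : set R) : {within A, continuous h}.
Proof.
apply: continuous_subspaceT => x; apply: differentiable_continuous.
by apply/derivable1_diffP; case: (hh.2 x).
Qed.

Lemma positive_contraction_lt : {mono h : x y / x < y}.
Proof.
apply/leW_mono/le_mono => x y xy.
apply: (@gtr0_derive1_lt_cc _ h x y) => //.
- by move=> z _; case: (hh.2 z).
- by move=> z _; case: (hh.2 z).
- exact: positive_contraction_continuous.
- by rewrite in_itv/= lexx ltW.
- by rewrite in_itv/= lexx ltW.
Qed.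

Lemma positive_contraction_le : {mono h : x y / x <= y}.
Proof. by apply: le_mono => x y; rewrite positive_contraction_lt. Qed.

Lemma positive_contraction_surj (z : R) :
  h 0 <= z <= h 1 -> exists2 y, 0 <= y <= 1 & h y = z.
Proof.
move=> hz; have [|y] := @IVT R h 0 1 z ler01 (positive_contraction_continuous _).
  by rewrite min_l ?max_r ?positive_contraction_le ?ler01.
by rewrite in_itv/=; exists y.
Qed.

Lemma positive_contraction_surj_oo (z : R) :
  h 0 < z < h 1 -> (h @` `]0, 1[) z.
Proof.
move=> /andP[z0 z1]; have [|y y01 hy] := positive_contraction_surj z.
  by rewrite !ltW.
exists y => //=; rewrite in_itv/=.
by rewrite -(positive_contraction_lt 0 y) -(positive_contraction_lt y 1) hy z0.
Qed.

Context (mu : probability (measurableTypeR R) R).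

(** The mass [mu] gives to the points that [h] sends to [x] or to its left,
i.e. the distribution function of the image of [mu] under [h]. *)
Definition branch_cdf (x : R) : R := fine (mu (h @^-1` `]-oo, x])).

Lemma measurable_branch x : measurable (h @^-1` `]-oo, x] : set (measurableTypeR R)).
Proof.
rewrite -[X in measurable X]setTI.
apply: (@nondecreasing_measurable R setT h) => //.
by move=> y z yz; rewrite positive_contraction_le.
Qed.

Lemma branch_cdfE x : mu (h @^-1` `]-oo, x]) = (branch_cdf x)%:E.
Proof. by rewrite /branch_cdf fineK// fin_num_measure//; exact: measurable_branch. Qed.

Lemma branch_cdf_ge0 x : 0 <= branch_cdf x.
Proof. exact: fine_ge0. Qed.

Lemma branch_cdf_at y : branch_cdf (h y) = cdfR mu y.
Proof.
congr (fine (mu _)); apply/seteqP; split => z /=; rewrite !in_itv/=;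
  by rewrite positive_contraction_le.
Qed.

Hypothesis mu01 : mu `[0, 1]%classic = 1%E.

Lemma branch_cdf_eq1 x : h 1 <= x -> branch_cdf x = 1.
Proof.
move=> hx; apply/eqP; rewrite eq_le -!lee_fin -branch_cdfE.
rewrite probability_le1 /=; last exact: measurable_branch.
rewrite -mu01; apply: le_measure; rewrite ?inE//; first exact: measurable_branch.
move=> y /=; rewrite !in_itv/= => /andP[_ y1].
by rewrite (le_trans _ hx)// positive_contraction_le.
Qed.

Lemma branch_cdf_eq0 x : x < h 0 -> branch_cdf x = 0.
Proof.
move=> hx; apply/eqP; rewrite eq_le branch_cdf_ge0 andbT -lee_fin -branch_cdfE.
rewrite -[leRHS](measure0 mu).
apply: (@le_probability_full _ (measurableTypeR R) _ mu _ _ `[0, 1]%classic) => //.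
  exact: measurable_branch.
move=> y [] /=; rewrite !in_itv/= => yx /andP[y0 _].
have := le_lt_trans yx hx; rewrite positive_contraction_lt => /(le_lt_trans y0).
by rewrite ltxx.
Qed.

End increasing_branch.
Arguments branch_cdf {R} h mu x.

(** * Stochastic dominance between stationary measures *)

Section IFS.
Context {R : realType} {k : nat} {f : 'I_k -> R -> R}.
Hypothesis hf : positive_IFS f.
Hypothesis hord : forall i j : 'I_k, j = i.+1 :> nat ->
  Num.max (f i 0) (f i 1) <= Num.max (f j 0) (f j 1).
Hypothesis hdisj : forall i j : 'I_k, i != j ->
  (f i @` `]0, 1[) `&` (f j @` `]0, 1[) = set0.

Let contr i : positive_lipschitz_contraction (f i) := (hf i).1.

Let f01 i : f i 0 < f i 1.
Proof. by rewrite (positive_contraction_lt (contr i)) ltr01. Qed.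

Lemma IFS_right_endpoint_le (i j : 'I_k) : (i <= j)%N -> f i 1 <= f j 1.
Proof.
case: j => j jk; elim: j jk => [|j IH] jk ij.
  by have -> : i = Ordinal jk by apply/val_inj/eqP; rewrite -leqn0.
move: ij; rewrite leq_eqVlt => /predU1P[ij|ij].
  by have -> : i = Ordinal jk by exact/val_inj.
apply: le_trans (IH (ltnW jk) ij) _.
have := hord (Ordinal (ltnW jk)) (Ordinal jk) erefl.
by rewrite !max_r// ltW.
Qed.

(** If [f j 0 < f i 1], the midpoint [z] of the overlap of the two image
intervals is attained by both branches inside ]0, 1[. *)
Lemma IFS_branches_ordered (i j : 'I_k) : (i < j)%N -> f i 1 <= f j 0.
Proof.
move=> ij; rewrite leNgt; apply/negP => ji.
have ij1 := IFS_right_endpoint_le i j (ltnW ij).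
pose a := Num.max (f i 0) (f j 0).
have a1 : a < f i 1 by rewrite gt_max f01 ji.
have [az z1] := midf_lt a1; set z := (_ / _) in az z1.
move: az; rewrite gt_max => /andP[iz jz].
have nij : i != j by rewrite neq_ltn ij.
have : ((f i @` `]0, 1[) `&` (f j @` `]0, 1[)) z.
  split; apply: positive_contraction_surj_oo (contr _) _ _.
    by rewrite iz z1.
  by rewrite jz (lt_le_trans z1 ij1).
by rewrite hdisj.
Qed.

Lemma branch_cdf_nonincreasing (mu : probability (measurableTypeR R) R) x (i j : 'I_k) :
  mu `[0, 1]%classic = 1%E -> (i < j)%N ->
  branch_cdf (f j) mu x <= branch_cdf (f i) mu x.
Proof.
move=> mu01 ij; have [i1|i1] := leP (f i 1) x.
  rewrite (branch_cdf_eq1 (contr i) mu mu01 _ i1) -lee_fin -branch_cdfE//.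
  by rewrite probability_le1//; exact: measurable_branch.
rewrite (branch_cdf_eq0 (contr j) mu mu01) ?branch_cdf_ge0//.
exact: lt_le_trans i1 (IFS_branches_ordered i j ij).
Qed.

Lemma stationary_cdf (p : 'I_k -> R) (mu : probability (measurableTypeR R) R) x :
  stationary_measure f p mu ->
  cdfR mu x = \sum_(i < k) p i * branch_cdf (f i) mu x.
Proof.
move=> [_ st]; apply: EFin_inj; rewrite -cdfRE st// -sumEFin.
by apply: eq_bigr => i _; rewrite (branch_cdfE (contr i)) EFinM.
Qed.

Section dominance.
Context {p q : 'I_k -> R} {mu nu : probability (measurableTypeR R) R}.
Hypotheses (p0 : forall i, 0 <= p i) (p1 : forall i, p i < 1).
Hypothesis pq : forall m : nat, (1 <= m <= k)%N ->
  0 <= \sum_(i < k | (i < m)%N) (p i - q i).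
Hypotheses (stmu : stationary_measure f p mu) (stnu : stationary_measure f q nu).

(* The remaining term, minus the sum of the [(p i - q i) * b i], is nonpositive
   by Abel summation. *)
Let diff_le x : cdfR nu x - cdfR mu x <=
  \sum_(i < k) p i * (branch_cdf (f i) nu x - branch_cdf (f i) mu x).
Proof.
rewrite (stationary_cdf _ _ _ stmu) (stationary_cdf _ _ _ stnu).
rewrite -subr_ge0 -!sumrB.
rewrite (eq_bigr (fun i => (p i - q i) * branch_cdf (f i) nu x)); last first.
  by move=> i _; ring.
apply: sum_ord_partial_sums_ge0 => // [i|i j ij]; first exact: branch_cdf_ge0.
exact: branch_cdf_nonincreasing stnu.1 ij.
Qed.

(* At most one branch has [x] between its endpoint values; the others
   contribute nothing. *)
Let diff_contract c D x : 0 <= c -> 0 <= D -> (forall i, p i <= c) ->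
  (forall y, cdfR nu y - cdfR mu y <= D) ->
  cdfR nu x - cdfR mu x <= c * D.
Proof.
move=> c0 D0 pc HD; apply: (le_trans (diff_le x)).
have eq1 i : f i 1 <= x -> branch_cdf (f i) nu x - branch_cdf (f i) mu x = 0.
  move=> i1; rewrite (branch_cdf_eq1 (contr i) _ stnu.1 _ i1).
  by rewrite (branch_cdf_eq1 (contr i) _ stmu.1 _ i1) subrr.
have eq0 i : x < f i 0 -> branch_cdf (f i) nu x - branch_cdf (f i) mu x = 0.
  move=> i1; rewrite (branch_cdf_eq0 (contr i) _ stnu.1 _ i1).
  by rewrite (branch_cdf_eq0 (contr i) _ stmu.1 _ i1) subrr.
have [/existsP[i /andP[i0 i1]]|/existsPn none] :=
    boolP [exists i, (f i 0 <= x) && (x < f i 1)]; last first.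
  rewrite big1 ?mulr_ge0// => i _; have := none i; rewrite negb_and -ltNge -leNgt.
  by move=> /orP[/eq0->|/eq1->]; rewrite mulr0.
rewrite (bigD1 i)//= big1 ?addr0 => [|j ji]; last first.
  move: ji; rewrite neq_ltn => /orP[ji|ij].
    by rewrite eq1 ?mulr0// (le_trans (IFS_branches_ordered _ _ ji)).
  by rewrite eq0 ?mulr0// (lt_le_trans i1 (IFS_branches_ordered _ _ ij)).
have [|y _ <-] := @positive_contraction_surj _ _ (contr i) x.
  by rewrite i0 ltW.
rewrite !(branch_cdf_at (contr i)) (le_trans (ler_wpM2l (p0 i) (HD y)))//.
exact: ler_wpM2r.
Qed.

(** The difference [cdfR nu - cdfR mu] has a supremum [D] with [D <= c * D]. *)
Lemma stationary_cdf_le x : cdfR nu x <= cdfR mu x.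
Proof.
have [c [c0 c1 pc]] := exists_lt1_bound _ _ p p1.
pose S := [set cdfR nu y - cdfR mu y | y in [set: R]].
have S1 y : cdfR nu y - cdfR mu y <= 1.
  by rewrite lerBlDr (le_trans (cdfR_le1 nu y))// lerDl cdfR_ge0.
have ubS : has_ubound S by exists 1 => _ [y _ <-].
have supS y : cdfR nu y - cdfR mu y <= sup S.
  by apply: ub_le_sup => //; exists y.
(* Both distribution functions equal 1 at the point 1. *)
have D0 : 0 <= sup S.
  have := supS 1; rewrite (cdfR_eq1 _ stnu.1)// (cdfR_eq1 _ stmu.1)//.
  by rewrite subrr.
have : sup S <= c * sup S.
  apply: ge_sup; first by exists (cdfR nu 0 - cdfR mu 0), 0.
  by move=> _ [y _ <-]; exact: diff_contract.
rewrite -subr_ge0 -{2}[sup S]mul1r -mulrBl nmulr_rge0 ?subr_lt0// => D0'.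
by rewrite -subr_le0 (le_trans (supS x)).
Qed.

End dominance.
End IFS.

Theorem theorem2p5 (R : realType) (k : nat) (f : 'I_k -> R -> R)
    (hf : positive_IFS f)
    (hord : forall i j : 'I_k, j = i.+1 :> nat ->
       Num.max (f i 0) (f i 1) <= Num.max (f j 0) (f j 1))
    (hdisj : forall i j : 'I_k, i != j ->
       (f i @` `]0, 1[) `&` (f j @` `]0, 1[) = set0)
    (p q : 'I_k -> R)
    (hp : probability_vector p) (hp01 : forall i : 'I_k, 0 < p i < 1)
    (hq : probability_vector q) (hq01 : forall i : 'I_k, 0 < q i < 1)
    (hpq : (forall m : nat, (1 <= m <= k)%N ->
              0 <= \sum_(i < k | (i < m)%N) (p i - q i)) \/
           (forall m : nat, (1 <= m <= k)%N ->
              \sum_(i < k | (i < m)%N) (p i - q i) <= 0))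
    (mu nu : probability (measurableTypeR R) R)
    (hmu : stationary_measure f p mu) (hnu : stationary_measure f q nu) :
  W1 mu nu =
    (`| \int[mu]_(x in `[0%R, 1%R]) x%:E - \int[nu]_(x in `[0%R, 1%R]) x%:E |)%E.
Proof.
have p1 i : p i < 1 by case/andP: (hp01 i).
have q1 i : q i < 1 by case/andP: (hq01 i).
case: hpq => hpq.
  by apply: W1_of_cdf_le hmu.1 hnu.1 _; exact: stationary_cdf_le hp.1 p1 hpq hmu hnu.
(* Exchanging the roles of the two measures negates the partial sums. *)
rewrite W1C abse_subC ?(mean01_fin_num _ _ hnu.1)//.
apply: W1_of_cdf_le hnu.1 hmu.1 _.
apply: stationary_cdf_le hq.1 q1 _ hnu hmu => // m mk.
rewrite -oppr_le0 -sumrN; under eq_bigr do rewrite opprB.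
exact: hpq.
Qed.
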